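(* Let $G$ be a countable locally nilpotent group (every finitely generated subgroup of $G$ is nilpotent) acting in a Borel fashion on a standard Borel space $X$. Then the induced orbit equivalence relation $E^X_G=\{(x,y)\in X\times X : \exists g\in G,\ g\cdot x=y\}$ is hyperfinite.
   Context: A Borel equivalence relation $E$ on a standard Borel space is hyperfinite if it is the union of an increasing sequence of finite Borel equivalence relations (equivalence relations all of whose classes are finite). *)

(* Defs.v *)
From HB Require Import structures.
From mathcomp Require Import all_boot all_order all_algebra.
From mathcomp Require Import all_classical all_reals all_analysis.
From Stdlib Require Rdefinitions.
From mathcomp Require Import Rstruct.
Notation R := Rdefinitions.R.
Set Implicit Arguments. Unset Strict Implicit. Unset Printing Implicit Defensive.
Import Order.TTheory GRing.Theory Num.Theory.
Local Open Scope classical_set_scope.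
Local Open Scope ring_scope.

Record is_group (G : Type) (mul : G -> G -> G) (one : G) (inv : G -> G) : Prop := {
  grp_assoc : forall a b c, mul a (mul b c) = mul (mul a b) c;
  grp_mul1g : forall a, mul one a = a;
  grp_mulg1 : forall a, mul a one = a;
  grp_mulVg : forall a, mul (inv a) a = one;
  grp_mulgV : forall a, mul a (inv a) = one }.

Definition countable_type (G : Type) : Prop := exists f : G -> nat, injective f.

Section GroupDefs.
Variables (G : Type) (mul : G -> G -> G) (one : G) (inv : G -> G).

Inductive gen (S : set G) : G -> Prop :=
| gen_in x : S x -> gen S x
| gen_one : gen S one
| gen_mul x y : gen S x -> gen S y -> gen S (mul x y)
| gen_inv x : gen S x -> gen S (inv x).

Definition comm (a b : G) : G := mul (mul (inv a) (inv b)) (mul a b).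

(* lower central series of a subgroup H: lcs H 0 = H = gamma_1(H),
   lcs H (n+1) = [lcs H n, H] = gamma_{n+2}(H) *)
Fixpoint lcs (H : set G) (n : nat) : set G :=
  match n with
  | 0 => H
  | n.+1 => gen [set c | exists a b, lcs H n a /\ H b /\ c = comm a b]
  end.

Definition nilpotent_subgroup (H : set G) : Prop :=
  exists n, lcs H n `<=` [set one].

Definition locally_nilpotent : Prop :=
  forall S : set G, finite_set S -> nilpotent_subgroup (gen S).
End GroupDefs.

Section Metric.
Variable (T : Type) (d : T -> T -> R).

Definition is_metric : Prop :=
  [/\ forall x y, 0 <= d x y,
      forall x y, d x y = 0 <-> x = y,
      forall x y, d x y = d y x &
      forall x y z, d x z <= d x y + d y z].

Definition metric_open (U : set T) : Prop :=
  forall x, U x -> exists2 e : R, 0 < e & forall y, d x y < e -> U y.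

Definition metric_complete : Prop :=
  forall u : nat -> T,
    (forall e : R, 0 < e -> exists N, forall m n, (N <= m)%N -> (N <= n)%N -> d (u m) (u n) < e) ->
    exists l, forall e : R, 0 < e -> exists N, forall n, (N <= n)%N -> d (u n) l < e.

Definition metric_separable : Prop :=
  exists2 D : set T, countable D &
    forall x (e : R), 0 < e -> exists2 y, D y & d x y < e.
End Metric.

Definition standard_borel (disp : measure_display) (X : measurableType disp) : Prop :=
  exists d : X -> X -> R,
    [/\ is_metric d, metric_complete d, metric_separable d &
        @measurable _ X = <<s metric_open d >>].

Definition borel_action (G : Type) (mul : G -> G -> G) (one : G)
  (disp : measure_display) (X : measurableType disp) (act : G -> X -> X) : Prop :=
  [/\ forall x, act one x = x,
      forall g h x, act (mul g h) x = act g (act h x) &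
      forall g, measurable_fun setT (act g)].

Definition orbit_eqrel (G : Type) (X : Type) (act : G -> X -> X) (x y : X) : Prop :=
  exists g, act g x = y.

Definition is_equivalence (X : Type) (F : X -> X -> Prop) : Prop :=
  [/\ forall x, F x x, forall x y, F x y -> F y x &
      forall x y z, F x y -> F y z -> F x z].

Definition borel_rel (disp : measure_display) (X : measurableType disp)
  (F : X -> X -> Prop) : Prop :=
  measurable [set p : (X * X)%type | F p.1 p.2].

Definition finite_eqrel (X : Type) (F : X -> X -> Prop) : Prop :=
  is_equivalence F /\ forall x, finite_set [set y | F x y].

Definition hyperfinite (disp : measure_display) (X : measurableType disp)
  (E : X -> X -> Prop) : Prop :=
  exists F : nat -> X -> X -> Prop,
    [/\ forall n, finite_eqrel (F n) /\ borel_rel (F n),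
        forall n x y, F n x y -> F n.+1 x y &
        forall x y, E x y <-> exists n, F n x y].

(* Main.v *)
Require Import Defs.
From HB Require Import structures.
From mathcomp Require Import all_boot all_order all_algebra.
From mathcomp Require Import all_classical all_reals all_analysis.
From mathcomp Require Import Rstruct zify.

Set Implicit Arguments. Unset Strict Implicit. Unset Printing Implicit Defensive.
Import Order.TTheory GRing.Theory Num.Theory.
Local Open Scope classical_set_scope.

(* It suffices to find finite Borel equivalence relations E_0, E_1, ... (not
   nested) such that every pair of points in the same orbit is in E_s for all
   large s: the intersections of the E_k over k >= m then increase to the orbit
   relation.  Each E_s is the kernel of a Borel map X -> X moving points along
   a bounded part of the orbit.

   Write G as the union of finitely generated subgroups G_s.  By nilpotency G_s
   has polynomial growth, hence so do its Schreier graphs (with uniform bounds,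
   even where the action is not free), and there is d_s such that for all T and
   m one finds m such maps with every T-ball cut by at most d_s of them.

   A large but fixed number of maps ("spares") at stage s can be used to perturb
   arbitrarily many much coarser maps of stage s + 1, in such a way that every
   small set is cut by at most as many new maps as old ones (refine_family).
   At each stage one map is set aside as E_s and the others serve as spares.
   The number of maps of stage s cutting a given small set is a nonincreasing
   natural number that drops whenever E_s cuts the set, so this happens only
   finitely often. *)

(** * Growth of nilpotent groups *)

Lemma leq_expl m n k : m <= n -> m ^ k <= n ^ k.
Proof. by case: k => [|k] mn; rewrite ?expn0 ?leq_exp2r. Qed.

Section WordBalls.
Variables (G : eqType) (mul : G -> G -> G) (one : G) (inv : G -> G).
Hypothesis HG : is_group mul one inv.

Lemma grp_invK : involutive inv.
Proof.
move=> a; rewrite -[inv (inv a)](grp_mulg1 HG) -(grp_mulVg HG a).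
by rewrite (grp_assoc HG) (grp_mulVg HG) (grp_mul1g HG).
Qed.

Lemma grp_mulgK a b : mul (mul a b) (inv b) = a.
Proof. by rewrite -(grp_assoc HG) (grp_mulgV HG) (grp_mulg1 HG). Qed.

Lemma grp_mulKg a b : mul (inv a) (mul a b) = b.
Proof. by rewrite (grp_assoc HG) (grp_mulVg HG) (grp_mul1g HG). Qed.

Lemma grp_mulVKg a b : mul a (mul (inv a) b) = b.
Proof. by rewrite (grp_assoc HG) (grp_mulgV HG) (grp_mul1g HG). Qed.

Lemma inv_unique a b : mul a b = one -> b = inv a.
Proof. by move=> ab; rewrite -[b](grp_mulKg a) ab (grp_mulg1 HG). Qed.

Lemma grp_invM a b : inv (mul a b) = mul (inv b) (inv a).
Proof.
apply/esym/inv_unique; rewrite (grp_assoc HG) -[mul (mul a b) _](grp_assoc HG).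
by rewrite (grp_mulgV HG) (grp_mulg1 HG) (grp_mulgV HG).
Qed.

Lemma grp_inv1 : inv one = one.
Proof. by apply/esym/inv_unique; rewrite (grp_mul1g HG). Qed.

(** Since [one] is a letter, the words of length exactly [n] that make up [wball F n] fill the whole
    ball of radius [n], and the balls are nested. *)
Definition letters (F : seq G) : seq G := one :: F ++ map inv F.

Fixpoint wball (F : seq G) (n : nat) : seq G :=
  if n is n'.+1 then [seq mul s h | s <- letters F, h <- wball F n'] else [:: one].

Definition growth (F : seq G) (n : nat) : nat := size (undup (wball F n)).

Lemma mem_letters F g : (g \in letters F) = [|| g == one, g \in F | inv g \in F].
Proof.
rewrite inE mem_cat; congr (_ || (_ || _)); apply/mapP/idP => [[h hF ->]|gF].
  by rewrite grp_invK.
by exists (inv g); rewrite ?grp_invK.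
Qed.

Lemma letters_inv F g : g \in letters F -> inv g \in letters F.
Proof.
rewrite !mem_letters => /or3P[/eqP->|gF|gF]; first by rewrite grp_inv1 eqxx.
  by rewrite grp_invK gF !orbT.
by rewrite gF orbT.
Qed.

Lemma letters_sub F F' : {subset F <= F'} -> {subset letters F <= letters F'}.
Proof.
move=> sF g; rewrite !mem_letters => /or3P[->//|/sF->|/sF->]; rewrite !orbT //.
Qed.

Lemma wballS F n g :
  reflect (exists s h, [/\ s \in letters F, h \in wball F n & g = mul s h])
          (g \in wball F n.+1).
Proof.
apply: (iffP allpairsP) => [[[s h] [/= sF hF ->]]|[s [h [sF hF ->]]]].
  by exists s, h.
by exists (s, h).
Qed.

Lemma wball_one F n : one \in wball F n.
Proof.
elim: n => [|n IH]; first by rewrite inE.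
by apply/wballS; exists one, one; split; rewrite ?(grp_mul1g HG) ?mem_head.
Qed.

Lemma wball_letter F g : g \in letters F -> g \in wball F 1.
Proof.
move=> gF; apply/wballS; exists g, one; split=> //; first exact: mem_head.
by rewrite (grp_mulg1 HG).
Qed.

Lemma wballM F m n g h :
  g \in wball F m -> h \in wball F n -> mul g h \in wball F (m + n).
Proof.
elim: m g => [|m IH] g; first by rewrite inE => /eqP->; rewrite (grp_mul1g HG).
move=> /wballS[s [k [sF km ->]]] hn; rewrite addSn; apply/wballS.
by exists s, (mul k h); rewrite IH // (grp_assoc HG).
Qed.

Lemma wball_mono F m n : m <= n -> {subset wball F m <= wball F n}.
Proof.
move=> mn g gm; rewrite -(subnKC mn) -[g](grp_mulg1 HG).
by apply: wballM => //; apply: wball_one.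
Qed.

Lemma wballV F n g : g \in wball F n -> inv g \in wball F n.
Proof.
elim: n g => [|n IH] g; first by rewrite !inE => /eqP->; rewrite grp_inv1.
move=> /wballS[s [h [sF hn ->]]]; rewrite grp_invM -addn1.
by apply: wballM; [exact: IH|exact/wball_letter/letters_inv].
Qed.

Lemma wball_sub F F' n : {subset F <= F'} -> {subset wball F n <= wball F' n}.
Proof.
move=> sF; elim: n => [|n IH] g //= /wballS[s [h [sF' hn ->]]].
by apply/wballS; exists s, h; split=> //; [exact: letters_sub sF'|exact: IH].
Qed.

Lemma growth_gt0 F n : 0 < growth F n.
Proof.
rewrite /growth lt0n size_eq0; apply/eqP => F0.
by have := wball_one F n; rewrite -mem_undup F0.
Qed.

Lemma growth_sub F F' n : {subset F <= F'} -> growth F n <= growth F' n.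
Proof.
move=> sF; apply: uniq_leq_size (undup_uniq _) _ => g.
by rewrite !mem_undup; apply: wball_sub.
Qed.

Notation genl F := (gen mul one inv [set x | x \in (F : seq G)]).

Lemma letters_gen F g : g \in letters F -> genl F g.
Proof.
rewrite mem_letters => /or3P[/eqP->|gF|gF]; first exact: gen_one.
  exact: gen_in.
by rewrite -[g]grp_invK; apply/gen_inv/gen_in.
Qed.

Lemma gen_wball F g : genl F g -> exists n, g \in wball F n.
Proof.
elim=> [x xF||x y _ [m xm] _ [n yn]|x _ [m xm]].
- by exists 1; apply: wball_letter; rewrite mem_letters xF orbT.
- by exists 0; rewrite inE.
- by exists (m + n); apply: wballM.
- by exists m; apply: wballV.
Qed.

Lemma gen_sub (S S' : set G) g :
  S `<=` S' -> gen mul one inv S g -> gen mul one inv S' g.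
Proof.
move=> sS; elim=> [x /sS|||]; [exact: gen_in|exact: gen_one| |].
  by move=> *; apply: gen_mul.
by move=> *; apply: gen_inv.
Qed.

(** * Conjugation and central lists in nilpotent groups *)

Definition grp_conjg (a b : G) : G := mul (inv b) (mul a b).

Lemma grp_conjgE a b : grp_conjg a b = mul a (comm mul inv a b).
Proof.
by rewrite /comm -!(grp_assoc HG) grp_mulVKg.
Qed.

Lemma grp_conjgM a b c : grp_conjg (mul a b) c = mul (grp_conjg a c) (grp_conjg b c).
Proof. by rewrite /grp_conjg -!(grp_assoc HG) grp_mulVKg. Qed.

Lemma grp_conjMg a b c : grp_conjg a (mul b c) = grp_conjg (grp_conjg a b) c.
Proof. by rewrite /grp_conjg grp_invM -!(grp_assoc HG). Qed.

Lemma grp_conj1g c : grp_conjg one c = one.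
Proof. by rewrite /grp_conjg (grp_mul1g HG) (grp_mulVg HG). Qed.

Lemma grp_conjg1 c : grp_conjg c one = c.
Proof. by rewrite /grp_conjg grp_inv1 (grp_mul1g HG) (grp_mulg1 HG). Qed.

Lemma grp_conjVg a c : grp_conjg (inv a) c = inv (grp_conjg a c).
Proof. by rewrite /grp_conjg !grp_invM grp_invK (grp_assoc HG). Qed.

Lemma commE a b : comm mul inv a b = mul (inv a) (grp_conjg a b).
Proof. by rewrite grp_conjgE grp_mulKg. Qed.

Lemma comm1g a : comm mul inv one a = one.
Proof. by rewrite commE grp_conj1g (grp_mulg1 HG) grp_inv1. Qed.

(* Each [b] in [L] commutes with the elements of [P] modulo the subgroup
   generated by the elements after [b]. *)
Definition central_list (P : G -> Prop) (L : seq G) : Prop :=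
  forall h, P h -> forall cs b bs, L = cs ++ b :: bs -> genl bs (comm mul inv b h).

(** The list starts with [F], continues with the commutators of its entries with letters, then with
    the commutators of those, and so on; after [n] rounds only the identity is left. Using letters
    alone keeps every round finite. *)
Lemma lcs_central_list (F : seq G) (H := genl F) n :
  lcs mul one inv H n `<=` [set one] ->
  exists L, [/\ {subset F <= L}, forall g, g \in L -> H g &
    central_list (fun h => h \in letters F) L].
Proof.
move=> lcs1.
(* Induction on the number [k] of rounds left, the current entries [A] lying in term [i] of the
   series. *)
suff: forall k i, i + k = n -> forall A : seq G,
    (forall g, g \in A -> lcs mul one inv H i g /\ H g) ->
    exists L, [/\ {subset A <= L}, forall g, g \in L -> H g &
      central_list (fun h => h \in letters F) L].
  move=> /(_ n 0 erefl F); apply=> g gF; split; exact: gen_in.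
elim=> [|k IH] i ikn A AH.
  have A1 g : g \in A -> g = one.
    by move=> /AH[]; rewrite -ikn addn0 in lcs1 => /lcs1.
  exists A; split=> // [g /AH[]//|h _ cs b bs eA].
  rewrite (A1 b) ?comm1g; first exact: gen_one.
  by rewrite eA mem_cat mem_head orbT.
(* The commutators of [A] with the letters lie in the next term of the lower
   central series: put [A] in front of a list for them. *)
have [||L [sL LH cL]] := IH i.+1 _ [seq comm mul inv b s | b <- A, s <- letters F].
- by rewrite addSnnS.
- move=> g /allpairsP[[b s] [/= /AH[bi bH] /letters_gen sF ->]]; split.
    by apply: gen_in; exists b, s.
  by apply: gen_mul; apply: gen_mul => //; apply: gen_inv.
exists (A ++ L); split=> [g gA|g|h hF].
- by rewrite mem_cat gA.
- by rewrite mem_cat => /orP[/AH[]|/LH].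
elim: A sL {AH} => [|a A IHA] sL [|c cs] b bs //=.
- exact: (cL h hF [::]).
- exact: (cL h hF (c :: cs)).
- case=> <- <-; apply: gen_sub (_ : [set x | x \in L] `<=` _) _.
    by move=> x /= xL; rewrite mem_cat xL orbT.
  apply: gen_in => /=; apply: sL; apply/allpairsP.
  by exists (a, h); rewrite /= mem_head.
- move=> [_]; apply: IHA => g /allpairsP[[b' s] [/= b'A sF ->]].
  by apply: sL; apply/allpairsP; exists (b', s); rewrite /= inE b'A orbT.
Qed.

(** A generator x of the tail has x^h = x [x, h], and [x, h] is generated by the entries after x.
    Conjugation by h is a homomorphism, so generators suffice. *)
Lemma central_list_conj P L h cs bs g : central_list P L -> P h -> L = cs ++ bs ->
  genl bs g -> genl bs (grp_conjg g h).
Proof.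
move=> cL Ph eL; elim=> [x|||].
- move=> /= xb; have [p [q eb]] : exists p q, bs = p ++ x :: q.
    by case/splitPr: xb => p q; exists p, q.
  rewrite grp_conjgE; apply: gen_mul; first exact: gen_in.
  have /(cL h Ph) : L = (cs ++ p) ++ x :: q by rewrite eL eb catA.
  by apply: gen_sub => y /= yq; rewrite eb mem_cat inE yq !orbT.
- by rewrite grp_conj1g; apply: gen_one.
- by move=> x y _ ? _ ?; rewrite grp_conjgM; apply: gen_mul.
- by move=> x _ ?; rewrite grp_conjVg; apply: gen_inv.
Qed.

(** Induction on word length through the identity [b, sk] = [b, k] [b, s]^k; by the induction
    hypothesis conjugation by k preserves the subgroup generated by the tail. *)
Lemma central_list_gen F L : central_list (fun h => h \in letters F) L ->
  central_list (genl F) L.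
Proof.
move=> cL h /gen_wball[n]; elim: n h => [|n IH] h.
  rewrite inE => /eqP-> cs b bs _.
  by rewrite commE grp_conjg1 (grp_mulVg HG); apply: gen_one.
move=> /wballS[s [k [sF kn ->]]] cs b bs eL.
have eL' : L = (cs ++ [:: b]) ++ bs by rewrite eL -catA.
have cLk : central_list (fun h => h = k) L by move=> _ ->; apply: IH.
rewrite commE grp_conjMg (grp_conjgE b) grp_conjgM (grp_assoc HG) -commE.
apply: gen_mul; first exact: IH eL.
by apply: (central_list_conj cLk erefl eL'); apply: cL sF _ _ _ eL.
Qed.

(** * Polynomial growth and doubling *)

Definition poly_bounded (f : nat -> nat) : Prop :=
  exists C D, forall n, f n <= C * n.+1 ^ D.

Definition gpow (t : G) (n : nat) : G := iter n (mul t) one.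

Lemma gpow_comm a t n : mul a t = mul t a -> mul a (gpow t n) = mul (gpow t n) a.
Proof.
move=> at_; elim: n => [|n IH] /=; first by rewrite (grp_mulg1 HG) (grp_mul1g HG).
by rewrite (grp_assoc HG) at_ -!(grp_assoc HG) IH.
Qed.

Lemma conjg_wball bs ts v q n h :
  (forall g, g \in letters bs -> grp_conjg g v \in wball ts q) ->
  h \in wball bs n -> grp_conjg h v \in wball ts (n * q).
Proof.
move=> bq; elim: n h => [|n IH] h.
  by rewrite inE => /eqP->; rewrite grp_conj1g wball_one.
move=> /wballS[s [k [sb kn ->]]]; rewrite grp_conjgM mulSn.
by apply: wballM; [exact: bq|exact: IH].
Qed.

Lemma conjg_gpow_growth t ts :
  central_list (fun h => h = t) ts ->
  exists C D, forall k g, g \in letters ts ->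
    grp_conjg g (gpow t k) \in wball ts (C * k.+1 ^ D).
Proof.
(* With w = [b, t], the conjugate of b by t^k is b * w * w^t * ... * w^(t^(k-1)). *)
elim: ts => [|b bs IH] cL.
  exists 0, 0 => k g; rewrite mem_letters !in_nil !orbF => /eqP->.
  by rewrite grp_conj1g wball_one.
have [|C [D CD]] := IH.
  by move=> h ht cs b' bs' e; apply: (cL h ht (b :: cs)); rewrite e.
have /gen_wball[c wc] := cL t erefl [::] b bs erefl.
have bsub : {subset bs <= b :: bs} by move=> g gb; rewrite inE gb orbT.
(* [K] is fixed before the induction on [k] so that all factors cost the same: w is a word of length
   [c] in [bs], and conjugation stretches each of its letters to length at most C (K+1)^D. *)
have main K k : k <= K ->
    grp_conjg b (gpow t k) \in wball (b :: bs) (1 + k * (c * (C * K.+1 ^ D))).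
  elim: k => [_|k IHk kK].
    by rewrite mul0n addn0 grp_conjg1; apply: wball_letter; rewrite mem_letters mem_head orbT.
  have -> : gpow t k.+1 = mul t (gpow t k) by [].
  rewrite grp_conjMg (grp_conjgE b) grp_conjgM mulSn [c * _ + _]addnC addnA; apply: wballM; first exact/IHk/ltnW.
  apply: (wball_sub bsub); apply: conjg_wball wc => g gb.
  apply: wball_mono (CD _ _ gb).
  by rewrite leq_mul2l leq_expl ?orbT // ltnS ltnW.
have mainb k : grp_conjg b (gpow t k) \in wball (b :: bs) ((c * C + 1 + C) * k.+1 ^ D.+1).
  apply: wball_mono (main k k (leqnn k)).
  by rewrite expnS; have := expn_gt0 k.+1 D; nia.
exists (c * C + 1 + C), D.+1 => k g; rewrite mem_letters => /or3P[/eqP->| |].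
- by rewrite grp_conj1g wball_one.
- rewrite inE => /orP[/eqP->//|gb]; apply: (wball_sub bsub).
  apply: wball_mono (CD k g _); last by rewrite mem_letters gb orbT.
  by rewrite expnS; have := expn_gt0 k.+1 D; nia.
- rewrite inE => /orP[/eqP gb|gb]; first by rewrite -[g]grp_invK gb grp_conjVg wballV.
  apply/(wball_sub bsub)/(wball_mono _ (CD k g _)); last by rewrite mem_letters gb !orbT.
  by rewrite expnS; have := expn_gt0 k.+1 D; nia.
Qed.

(** Collection: the letters [t] and [inv t] are moved to the left. A letter of [ts] that passes both
    powers is conjugated twice, each time stretched by a factor [Q]. Keeping the two powers apart
    avoids signed exponents. *)
Lemma wball_collect t ts N Q :
  (forall g k, g \in letters ts -> k <= N ->
     grp_conjg g (gpow t k) \in wball ts Q /\ grp_conjg g (gpow (inv t) k) \in wball ts Q) ->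
  forall n u, n <= N -> u \in wball (t :: ts) n ->
  exists i j u', [/\ i <= n, j <= n, u' \in wball ts (n * (Q * Q)) &
    u = mul (mul (gpow t i) (gpow (inv t) j)) u'].
Proof.
move=> tQ; elim=> [|n IH] u nN.
  rewrite inE => /eqP->; exists 0, 0, one.
  by rewrite inE eqxx /= !(grp_mul1g HG).
move=> /wballS[s [h [st hn ->]]].
have [i [j [u' [il jl u'n ->]]]] := IH h (ltnW nN) hn.
have u'n1 : u' \in wball ts (n.+1 * (Q * Q)).
  by apply: wball_mono u'n; rewrite leq_mul2r leqnSn orbT.
have [sts|] := boolP (s \in letters ts).
  exists i, j, (mul (grp_conjg s (mul (gpow t i) (gpow (inv t) j))) u').
  split; [exact: leqW|exact: leqW| |].
    rewrite mulSn; apply: wballM u'n; rewrite grp_conjMg.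
    apply: conjg_wball (tQ s i sts (leq_trans il (ltnW nN))).1 => g gts.
    exact: (tQ g j gts (leq_trans jl (ltnW nN))).2.
  by rewrite [RHS](grp_assoc HG) grp_mulVKg (grp_assoc HG).
move: st; rewrite !mem_letters !inE => /or3P[->//| |] => /orP[/eqP st|->];
  rewrite ?orbT // => _.
- exists i.+1, j, u'; split=> //; first exact: leqW.
  by rewrite st /= !(grp_assoc HG).
- exists i, j.+1, u'; split=> //; first exact: leqW.
  have -> : s = inv t by rewrite -st grp_invK.
  have tVt : mul (inv t) t = mul t (inv t) by rewrite (grp_mulVg HG) (grp_mulgV HG).
  rewrite (grp_assoc HG (inv t)) (grp_assoc HG (inv t) (gpow t i)).
  by rewrite (gpow_comm _ tVt) -(grp_assoc HG (gpow t i)).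
Qed.

(** Induction on the list. After collection an element of the n-ball is determined by two exponents
    at most n and an element of a ball over the tail, whose radius is polynomial in n by
    [conjg_gpow_growth]. *)
Lemma central_list_growth (P : G -> Prop) L :
  (forall g, g \in L -> P g /\ P (inv g)) -> central_list P L ->
  poly_bounded (growth L).
Proof.
elim: L => [|t ts IH] LP cL.
  exists 1, 0 => n; rewrite expn0 mul1n.
  apply: (@uniq_leq_size _ _ [:: one] (undup_uniq _)) => g; rewrite mem_undup.
  elim: n g => [|n IHn] g // /wballS[s [h [s1 /IHn h1 ->]]].
  move: s1 h1; rewrite mem_letters !in_nil !orbF !inE => /eqP-> /eqP->.
  by rewrite (grp_mul1g HG).
have cts h : P h -> central_list (fun h' => h' = h) ts.
  by move=> Ph _ -> cs b bs e; apply: (cL h Ph (t :: cs)); rewrite e.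
have [||C' [D' gts]] := IH.
- by move=> g gts; apply: LP; rewrite inE gts orbT.
- by move=> h Ph cs b bs e; apply: (cts h Ph h erefl cs b bs e).
have [Pt Pt'] := LP t (mem_head _ _).
have [C1 [D1 CD1]] := conjg_gpow_growth (cts _ Pt).
have [C2 [D2 CD2]] := conjg_gpow_growth (cts _ Pt').
pose C := C1 + C2; pose D := D1 + D2.
(* The summand 2 counts the pairs of exponents. The radius [m] satisfies m+1 <= (C^2+1)(n+1)^(2D+1),
   and this is raised to the power [D']. *)
exists (C' * (C ^ 2).+1 ^ D'), (2 + (2 * D).+1 * D') => n.
pose Q := C * n.+1 ^ D; pose m := n * (Q * Q).
have gn : growth (t :: ts) n <= n.+1 ^ 2 * growth ts m.
  pose ij := [seq (i, j) | i <- iota 0 n.+1, j <- iota 0 n.+1].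
  have -> : n.+1 ^ 2 * growth ts m =
    size [seq mul (mul (gpow t p.1) (gpow (inv t) p.2)) u | p <- ij, u <- undup (wball ts m)].
    by rewrite !size_allpairs !size_iota.
  apply: uniq_leq_size (undup_uniq _) _ => u; rewrite mem_undup.
  move=> /(wball_collect (N := n) (Q := Q))[||i [j [u' [il jl u'm ->]]]] //.
    move=> g k gts' kn; split; [apply: wball_mono (CD1 _ _ gts')
                              |apply: wball_mono (CD2 _ _ gts')];
    rewrite /Q /C /D expnD; apply: leq_mul; rewrite ?leq_addr ?leq_addl //.
    - apply: leq_trans (leq_pmulr _ _); rewrite ?expn_gt0 //; exact: leq_expl.
    - apply: leq_trans (leq_pmull _ _); rewrite ?expn_gt0 //; exact: leq_expl.
  apply/allpairsP; exists ((i, j), u') => /=; rewrite mem_undup u'm; split=> //.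
  by apply/allpairsP; exists (i, j); split=> //; rewrite mem_iota add0n ltnS.
apply: (leq_trans gn); rewrite expnD [n.+1 ^ 2 * _]mulnC mulnCA [leqRHS]mulnC leq_mul2r.
apply/orP; right; apply: (leq_trans (gts m)).
rewrite -mulnA leq_mul2l expnM -expnMn; apply/orP; right.
have le : m.+1 <= (C ^ 2).+1 * n.+1 ^ (2 * D).+1.
  rewrite /m /Q; move: C D {Q m gn gts} => c d.
  rewrite -mulnn expnS mul2n -addnn expnD.
  by have := expn_gt0 n.+1 d; move: (n.+1 ^ d) => e; nia.
exact: leq_expl.
Qed.

Lemma nilpotent_growth (F : seq G) :
  nilpotent_subgroup mul one inv (genl F) -> poly_bounded (growth F).
Proof.
move=> [n /lcs_central_list[L [FL LH /central_list_gen cL]]].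
have [|C [D CD]] := central_list_growth _ cL.
  by move=> g /LH Hg; split=> //; apply: gen_inv.
exists C, D => k; exact: leq_trans (growth_sub _ FL) (CD k).
Qed.

(** If doubling failed from [r0] on, each multiplication of the radius by 5 would multiply [f] by
    more than 2 * 5^D, which outgrows degree [D]. *)
Lemma poly_bounded_doubling (f : nat -> nat) :
  (forall n, 0 < f n) -> poly_bounded f ->
  exists K, forall r0, exists2 r, r0 <= r & f (5 * r) <= K * f r.
Proof.
move=> f0 [C [D CD]]; exists (2 * 5 ^ D) => r0; apply: contrapT => nor.
(* After k steps the failure of doubling yields 2^k <= C (r0+2)^D; taking k equal to the right-hand
   side contradicts q < 2^q. *)
pose q := C * (r0 + 2) ^ D.
have grow k : (2 * 5 ^ D) ^ k <= f (5 ^ k * r0.+1).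
  elim: k => [|k IH]; first by rewrite expn0; apply: f0.
  rewrite [X in f X](_ : _ = 5 * (5 ^ k * r0.+1)); last by rewrite expnS mulnA.
  rewrite leqNgt; apply/negP => lt; apply: nor; exists (5 ^ k * r0.+1).
    by have := expn_gt0 5 k; nia.
  rewrite expnS in lt; apply: leq_trans (ltnW lt) _; exact: leq_mul.
have := leq_trans (grow q) (CD _); rewrite leqNgt => /negP; apply.
apply: leq_ltn_trans (_ : C * (5 ^ q * (r0 + 2)) ^ D < _).
  rewrite leq_mul2l; apply/orP; right; have := expn_gt0 5 q => ?.
  by apply: leq_expl; nia.
rewrite !expnMn -!expnM [5 ^ (q * D)]lock mulnCA -lock [D * q]mulnC -/q mulnC.
by rewrite ltn_pmul2r ?expn_gt0 // ltn_expl.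
Qed.

End WordBalls.

(** * Borel predicates and packing in Schreier graphs *)

Section MeasurablePredicates.
Variables (disp : measure_display) (X : measurableType disp).
Implicit Types P Q : X -> Prop.

Notation mpred P := (measurable ([set x | P x] : set X)).

Lemma mpred_const (p : Prop) : mpred (fun _ => p).
Proof.
have [hp|hp] := pselect p.
  by rewrite (_ : [set _ | p] = setT) //; apply/predeqP.
by rewrite (_ : [set _ | p] = set0) //; apply/predeqP.
Qed.

Lemma mpred_not P : mpred P -> mpred (fun x => ~ P x).
Proof. exact: measurableC. Qed.

Lemma mpred_and P Q : mpred P -> mpred Q -> mpred (fun x => P x /\ Q x).
Proof. exact: measurableI. Qed.

Lemma mpred_or P Q : mpred P -> mpred Q -> mpred (fun x => P x \/ Q x).
Proof. exact: measurableU. Qed.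

Lemma mpred_iff P Q : (forall x, P x <-> Q x) -> mpred Q -> mpred P.
Proof. by move=> PQ; rewrite (_ : [set x | P x] = [set x | Q x]) //; apply/predeqP. Qed.

Lemma mpred_imp P Q : mpred P -> mpred Q -> mpred (fun x => P x -> Q x).
Proof.
move=> mP mQ; apply: (@mpred_iff _ (fun x => ~ P x \/ Q x)); last first.
  by apply: mpred_or => //; apply: mpred_not.
move=> x; split=> [PQ|[nP /nP//|//]].
by have [/PQ|] := pselect (P x); [right|left].
Qed.

Lemma mpred_ex I (P : I -> X -> Prop) : countable_type I ->
  (forall i, mpred (P i)) -> mpred (fun x => exists i, P i x).
Proof.
move=> [c cI] mP; rewrite (_ : [set x | _] = \bigcup_i [set x | P i x]); last first.
  by apply/predeqP => x; split=> [[i Pi]|[i _ Pi]]; [exists i|exists i].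
by apply: countable_bigcupT_measurable => //; apply/countable_injP; exists c => ? ? _ _ /cI.
Qed.

Lemma mpred_all I (P : I -> X -> Prop) : countable_type I ->
  (forall i, mpred (P i)) -> mpred (fun x => forall i, P i x).
Proof.
move=> cI mP; apply: (@mpred_iff _ (fun x => ~ exists i, ~ P i x)).
  by move=> x; split=> [PP [i]|/forallNP nP i]; [exact|exact: contrapT (nP i)].
by apply/mpred_not/mpred_ex => // i; apply: mpred_not.
Qed.

Lemma mpred_comp P (f : X -> X) :
  measurable_fun setT f -> mpred P -> mpred (fun x => P (f x)).
Proof. by move=> mf mP; rewrite -[X in measurable X]setTI; apply: mf. Qed.

Lemma countable_countType (I : countType) : countable_type I.
Proof. by exists pickle; exact: (pcan_inj pickleK). Qed.

Lemma mpred_lift I (s : X -> I) (Q : I -> X -> Prop) : countable_type I ->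
  (forall i, mpred (fun x => s x = i)) -> (forall i, mpred (Q i)) ->
  mpred (fun x => Q (s x) x).
Proof.
move=> cI ms mQ; apply: (@mpred_iff _ (fun x => exists i, s x = i /\ Q i x)).
  by move=> x; split=> [?|[i [-> ?]]] //; exists (s x).
by apply: mpred_ex => // i; apply: mpred_and.
Qed.

(** The index of least code is chosen; being least is a countable conjunction of measurable
    conditions. *)
Lemma measurable_select I (Q : I -> X -> Prop) : countable_type I ->
  (forall i, mpred (Q i)) -> (forall x, exists i, Q i x) ->
  exists2 s : X -> I, forall x, Q (s x) x & forall i, mpred (fun x => s x = i).
Proof.
move=> cI mQ exQ; have [c inj_c] := cI.
have least x : exists i, Q i x /\ forall j, Q j x -> c i <= c j.
  have exn : exists n, `[<exists2 i, c i = n & Q i x>].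
    by have [i Qi] := exQ x; exists (c i); apply/asboolP; exists i.
  case: (ex_minnP exn) => n /asboolP[i <- Qi] min; exists i; split=> // j Qj.
  by apply: min; apply/asboolP; exists j.
have [s sP] := choice least; exists s => [x|i]; first by have [] := sP x.
apply: (@mpred_iff _ (fun x => Q i x /\ forall j, Q j x -> c i <= c j)).
  move=> x; split=> [<-//|[Qi min]]; have [Qs mins] := sP x.
  by apply: inj_c; apply/eqP; rewrite eqn_leq mins ?min.
apply: mpred_and => //; apply: mpred_all => // j.
by apply: mpred_imp => //; apply: mpred_const.
Qed.

End MeasurablePredicates.

Notation mpred P := (measurable [set x | P x]).

Section Packing.
Variables (G : eqType) (mul : G -> G -> G) (one : G) (inv : G -> G).
Hypothesis HG : is_group mul one inv.
Variables (X : eqType) (act : G -> X -> X).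
Hypothesis act1 : forall x, act one x = x.
Hypothesis actM : forall g h x, act (mul g h) x = act g (act h x).

(** Distance at most [r] in the Schreier graph of the letters of [F]. As a relation it needs no
    infinite value for points in different components. *)
Definition dle (F : seq G) (r : nat) (x y : X) : Prop :=
  exists2 g, g \in wball mul one inv F r & y = act g x.

Lemma dle_refl F r x : dle F r x x.
Proof. by exists one; rewrite ?act1 // wball_one. Qed.

Lemma dle_sym F r x y : dle F r x y -> dle F r y x.
Proof.
move=> [g gr ->]; exists (inv g); first exact: wballV.
by rewrite -actM (grp_mulVg HG) act1.
Qed.

Lemma dle_trans F r t x y z : dle F r x y -> dle F t y z -> dle F (r + t) x z.
Proof.
move=> [g gr ->] [h ht ->]; exists (mul h g); rewrite ?actM //.
by rewrite addnC; apply: wballM.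
Qed.

Lemma dle_mono F r t x y : r <= t -> dle F r x y -> dle F t x y.
Proof. by move=> rt [g /(wball_mono HG rt) gt ->]; exists g. Qed.

Lemma dle_sub F F' r x y : {subset F <= F'} -> dle F r x y -> dle F' r x y.
Proof. by move=> sF [g gr ->]; exists g => //; apply: wball_sub gr. Qed.

(** Volumes are compared in the group and not in the orbit, so that the bound depends neither on [x]
    nor on stabilizers. *)
Lemma packing F K r x (ys : seq X) :
  growth mul one inv F (5 * r) <= K * growth mul one inv F r ->
  uniq ys -> (forall y, y \in ys -> dle F (4 * r) x y) ->
  (forall y z, y \in ys -> z \in ys -> dle F (2 * r) y z -> y = z) ->
  size ys <= K.
Proof.
move=> dbl uys ysx sep.
have /choice[e eP] y : exists g, y \in ys ->
    g \in wball mul one inv F (4 * r) /\ y = act g x.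
  have [/ysx[g gr yg]|yN] := boolP (y \in ys); first by exists g.
  by exists one.
(* The translates of the r-ball of G by the e y are pairwise disjoint. *)
rewrite -(leq_pmul2r (growth_gt0 HG F r)); apply: leq_trans dbl.
rewrite /growth -(size_allpairs (fun y h => mul h (e y))).
apply: uniq_leq_size => [|g /allpairsP[[y h] [/= yys hr ->]]]; last first.
  rewrite mem_undup in hr; rewrite mem_undup (_ : 5 * r = r + 4 * r); last by lia.
  by apply: wballM => //; have [] := eP y yys.
apply: allpairs_uniq; rewrite ?undup_uniq //.
move=> p q /allpairsP[[y h] [/= yys + ->]] /allpairsP[[z k] [/= zys + ->]] /=.
rewrite !mem_undup => hr kr ehk.
have yz : y = z.
  apply: sep => //; exists (mul (inv k) h); first by rewrite mul2n -addnn wballM // wballV.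
  have [_ ey] := eP y yys; have [_ ez] := eP z zys.
  rewrite ez ey -actM -(grp_assoc HG) ehk (grp_assoc HG) (grp_mulVg HG).
  by rewrite (grp_mul1g HG).
by rewrite -yz in ehk *; rewrite -(grp_mulgK HG h (e y)) ehk (grp_mulgK HG).
Qed.

End Packing.

(** * Borel markers *)

Section CountablySeparated.
Variables (disp : measure_display) (X : measurableType disp).

(** The form in which standardness of the space enters: it makes coincidence of Borel maps a Borel
    condition. *)
Definition countably_separated : Prop :=
  exists2 U : nat -> set X, forall k, measurable (U k) &
    forall x y, x <> y -> exists k, U k x /\ ~ U k y.

Hypothesis sepX : countably_separated.

Lemma mpred_eq (f g : X -> X) :
  measurable_fun setT f -> measurable_fun setT g -> mpred (fun x => f x = g x).
Proof.
move=> mf mg; have [U mU sU] := sepX.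
apply: (@mpred_iff _ _ _ (fun x => ~ exists k, U k (f x) /\ ~ U k (g x))).
  move=> x; split=> [-> [k []//]|nU]; apply: contrapT => /sU; exact: nU.
apply/mpred_not/mpred_ex => [|k]; first exact: countable_countType.
apply: mpred_and; first exact: mpred_comp (mU k).
by apply/mpred_not/mpred_comp => //; exact: mU.
Qed.

Lemma borel_rel_ker (f : X -> X) :
  measurable_fun setT f -> borel_rel (fun x y => f x = f y).
Proof.
move=> mf; have [U mU sU] := sepX; rewrite /borel_rel.
rewrite (_ : [set p | _] =
    ~` \bigcup_k ([set x | U k (f x)] `*` [set x | ~ U k (f x)])); last first.
  apply/predeqP => -[x y] /=; split=> [fxy [k _ [/= kx]]|nU]; first by rewrite -fxy.
  by apply: contrapT => /sU[k [kx ky]]; apply: nU; exists k.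
apply/measurableC/bigcupT_measurable => k; apply: measurableX.
  exact: mpred_comp (mU k).
exact/mpred_not/mpred_comp/(mU k).
Qed.

Lemma separate_from_finite (U : nat -> set X) :
  (forall x y, x <> y -> exists k, U k x /\ ~ U k y) ->
  forall x (ys : seq X), exists s : seq nat, (forall k, k \in s -> U k x) /\
    forall y, y \in ys -> y <> x -> ~ (forall k, k \in s -> U k y).
Proof.
move=> sU x; elim=> [|y ys [s [sx sy]]]; first by exists [::].
have [<-|yx] := pselect (x = y).
  by exists s; split=> // z; rewrite inE => /orP[/eqP->|/sy].
have [k [kx ky]] := sU _ _ yx; exists (k :: s); split=> [j|z].
  by rewrite inE => /orP[/eqP->|/sx].
rewrite inE => /orP[/eqP->|zys] zx zs; first by apply/ky/zs/mem_head.
by apply: (sy z) => // j js; apply: zs; rewrite inE js orbT.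
Qed.

End CountablySeparated.

(** The separating sets are the balls of radius 1/(n+1) around points of a countable dense set,
    indexed by codes of pairs of a centre and [n]. *)
Lemma standard_borel_separated (disp : measure_display) (X : measurableType disp) :
  standard_borel X -> countably_separated X.
Proof.
move=> [d [[d0 deq dC dT] _ [D /countable_injP[c cD] dense] mX]].
pose U k x := exists q, exists2 n : nat,
  D q /\ pickle (c q, n) = k & (d q x < n.+1%:R^-1)%R.
exists U => [k|x y xy].
  rewrite mX; apply: sub_gen_smallest => x [q [n qk qx]].
  exists (n.+1%:R^-1 - d q x)%R => [|y xy]; first by rewrite subr_gt0.
  exists q, n => //; apply: le_lt_trans (dT q x y) _.
  by rewrite -ltrBrDl.
have exy : (0 < d x y)%R.
  by rewrite lt_neqAle d0 andbT eq_sym; apply/eqP => /deq.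
have [n /= n2] : exists n : nat, (n.+1%:R^-1 < d x y / 2)%R.
  have e0 : (0 < d x y / 2)%R by rewrite divr_gt0.
  exists (Num.truncn (d x y / 2)^-1)%R.
  rewrite invf_plt ?posrE //; exact: truncnS_gt.
have [q Dq xq] := dense x n.+1%:R^-1%R (ltac:(by rewrite invr_gt0)).
exists (pickle (c q, n)); split; first by exists q, n; rewrite // dC.
move=> [q' [n' [Dq' /(pcan_inj pickleK)[cq en]]] q'y].
have eq : q' = q by apply: cD; rewrite ?inE.
rewrite eq en in q'y; have := dT x q y; rewrite leNgt => /negP; apply.
by rewrite [ltRHS]splitr ltrD // ?(lt_trans xq) ?(lt_trans q'y).
Qed.

Section BadSets.
Variable X : Type.

Definition constant_on (C : X -> Prop) (f : X -> X) : Prop :=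
  forall x y, C x -> C y -> f x = f y.

Lemma constant_onS (C D : X -> Prop) f :
  (forall x, C x -> D x) -> constant_on D f -> constant_on C f.
Proof. by move=> CD Df x y /CD Dx /CD Dy; apply: Df. Qed.

(** This fixes what it means that a map cuts [C]: its kernel does not have [C] inside a single
    class. *)
Definition bad_set n (p : 'I_n -> X -> X) (C : X -> Prop) : {set 'I_n} :=
  [set j | ~~ `[< constant_on C (p j) >]].

Lemma bad_setP n (p : 'I_n -> X -> X) C j :
  reflect (~ constant_on C (p j)) (j \in bad_set p C).
Proof. by rewrite finset.inE; exact: asboolPn. Qed.

End BadSets.

Section Markers.
Variables (G : eqType) (mul : G -> G -> G) (one : G) (inv : G -> G).
Hypothesis HG : is_group mul one inv.
Hypothesis cG : countable_type G.
Variables (disp : measure_display) (X : measurableType disp).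
Hypothesis sepX : countably_separated X.
Variable act : G -> X -> X.
Hypothesis actX : borel_action mul one act.

Let act1 x : act one x = x. Proof. by have [H _ _] := actX. Qed.
Let actM g h x : act (mul g h) x = act g (act h x).
Proof. by have [_ H _] := actX. Qed.
Let mact g : measurable_fun setT (act g). Proof. by have [_ _ H] := actX. Qed.

Notation dist := (dle mul one inv act).

Lemma mpred_exdist F r (P : X -> Prop) :
  mpred P -> mpred (fun x => exists y, dist F r x y /\ P y).
Proof.
move=> mP; apply: (@mpred_iff _ _ _
  (fun x => exists g, g \in wball mul one inv F r /\ P (act g x))).
  by move=> x; split=> [[_ [[g gr ->] Py]]|[g [gr Pg]]];
    [exists g|exists (act g x); split=> //; exists g].
apply: mpred_ex => // g; apply: mpred_and; first exact: mpred_const.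
exact: mpred_comp (mact g) mP.
Qed.

(** The colour of [x] codes a finite intersection of separating sets that contains [x] and misses
    every translate of [x] by [S] other than [x]. A translate of the same colour lies in this
    intersection, hence equals [x]. *)
Lemma local_coloring (S : seq G) : exists2 nu : X -> nat,
  forall x g, g \in S -> nu (act g x) = nu x -> act g x = x &
  forall n, mpred (fun x => nu x = n).
Proof.
have [U mU sU] := sepX.
pose V (s : seq nat) x := forall k, k \in s -> U k x.
have mV s : mpred (V s).
  apply: mpred_all => [|k]; first exact: countable_countType.
  by apply: mpred_imp; [exact: mpred_const|exact: mU].
pose Q s x := V s x /\ forall g, g \in S -> act g x <> x -> ~ V s (act g x).
have [||s sQ ms] := @measurable_select _ X (seq nat) Q (countable_countType _).
- move=> s; apply: mpred_and => //; apply: mpred_all => // g.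
  apply: mpred_imp; first exact: mpred_const.
  apply: mpred_imp; first exact/mpred_not/mpred_eq.
  exact/mpred_not/mpred_comp.
- move=> x; have [s [Vx Vy]] := separate_from_finite sU x [seq act g x | g <- S].
  by exists s; split=> // g gS; apply/Vy/map_f.
exists (fun x => pickle (s x)) => [x g gS /(pcan_inj pickleK) eqs|n].
  apply: contrapT => gx; have [_ /(_ g gS gx)] := sQ x; apply.
  by rewrite -eqs; have [] := sQ (act g x).
apply: (@mpred_lift _ X (seq nat) s (fun s _ => pickle s = n)) => // [|t].
  exact: countable_countType.
exact: mpred_const.
Qed.

Lemma maximal_separated F r : exists Y : X -> Prop, [/\ mpred Y,
  forall x y, Y x -> Y y -> dist F r x y -> x = y &
  forall x, exists2 y, Y y & dist F r x y].
Proof.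
have [nu nu_inj mnu] := local_coloring (wball mul one inv F r).
(* Greedy choice, one colour class at a time. *)
pose Z := fix Z n x := if n is n'.+1 then
  Z n' x \/ nu x = n' /\ ~ exists y, dist F r x y /\ Z n' y else False.
have mZ n : mpred (Z n).
  elim: n => [|n IH] /=; first exact: mpred_const.
  by apply: mpred_or => //; apply: mpred_and => //; apply/mpred_not/mpred_exdist.
have Zmono m n x : m <= n -> Z m x -> Z n x.
  move=> /subnKC <-; elim: (n - m) => [|k IH]; first by rewrite addn0.
  by move=> /IH; rewrite addnS /=; left.
have Znu n x : Z n x -> nu x < n /\ forall y, Z (nu x) y -> ~ dist F r x y.
  elim: n => [//|n IH] /= [/IH[lt ?]|[-> no]]; first by rewrite ltnW.
  by split=> // y Zy xy; apply: no; exists y.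
(* A point can enter only in the round of its own colour, so the one of smaller colour is already
   present and blocks the other. *)
have lt_sep x y m n : Z m x -> Z n y -> nu x < nu y -> ~ dist F r x y.
  move=> /Znu[xm nox] /Znu[yn noy] xy /(dle_sym HG act1 actM); apply: noy.
  apply: Zmono xy _ => /=; right; split=> // -[z [xz /nox]]; exact.
exists (fun x => exists n, Z n x); split=> [|x y [m Zx] [n Zy] xy|x].
- by apply: mpred_ex => //; apply: countable_countType.
- have [lt|lt|eq] := ltngtP (nu x) (nu y).
  + by case: (lt_sep _ _ _ _ Zx Zy lt).
  + by case: (lt_sep _ _ _ _ Zy Zx lt); apply: dle_sym xy.
  + case: xy eq => g gr -> /esym eq; apply: esym; exact: nu_inj.
- have [[y [xy Zy]]|no] := pselect (exists y, dist F r x y /\ Z (nu x) y).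
    by exists y => //; exists (nu x).
  by exists x; [exists (nu x).+1; right|apply: dle_refl].
Qed.

(* [p j x] is the marker of least colour within [a j] of [x].  It cuts the
   T-ball of [x] only if there is a marker at distance between [a j - T] and
   [a j + T] of [x]; these shells are disjoint, so packing bounds the number
   of such [j]. *)
Lemma kolmogorov_family F :
  (exists K, forall r0, exists2 r, r0 <= r &
     growth mul one inv F (5 * r) <= K * growth mul one inv F r) ->
  exists d, forall T m, exists (p : 'I_m -> X -> X) (R : nat),
    [/\ forall j, measurable_fun setT (p j), forall j x, dist F R x (p j x) &
      forall x, #|bad_set p (dist F T x)| <= d].
Proof.
move=> [K doubling]; exists K => T m.
have [r rT gr] := doubling (m * T).
have [Y [mY Ysep Ymax]] := maximal_separated F (2 * r).
(* Markers chosen by points of one T-ball turn out to be at most 2 * [a j] <= 8 * [r] apart, so at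
   this radius their colours tell them apart. *)
have [nu nu_inj mnu] := local_coloring (wball mul one inv F (8 * r)).
(* The term 2 * [r] ensures a marker within reach. Consecutive shells meet end to end, as a j + T =
   a (j+1) - T, and all end by 4 * [r] because m * T <= r. *)
pose a j := 2 * r + (2 * j + 1) * T.
have aT j : j < m -> a j + T <= 4 * r by rewrite /a => jm; nia.
have mle (g h : G) : mpred (fun x => nu (act g x) <= nu (act h x)).
  have mn k n : mpred (fun x => nu (act k x) = n) by apply: mpred_comp (mnu n).
  apply: (@mpred_lift _ X nat (fun x => nu (act g x)) (fun n x => n <= nu (act h x))).
  - exact: countable_countType.
  - by move=> n; apply: mn.
  move=> n; apply: (@mpred_lift _ X nat (fun x => nu (act h x)) (fun k _ => n <= k)).
  - exact: countable_countType.
  - by move=> k; apply: mn.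
  - by move=> k; apply: mpred_const.
pose Q j g x := [/\ g \in wball mul one inv F (a j), Y (act g x) &
  forall h, h \in wball mul one inv F (a j) -> Y (act h x) -> nu (act g x) <= nu (act h x)].
have mQ j g : mpred (Q j g).
  apply: (@mpred_iff _ X _ (fun x => g \in wball mul one inv F (a j) /\
    (Y (act g x) /\ forall h, h \in wball mul one inv F (a j) -> Y (act h x) ->
       nu (act g x) <= nu (act h x)))).
    by move=> x; split=> [[]|[? []]].
  apply: mpred_and; first exact: mpred_const.
  apply: mpred_and; first exact: mpred_comp mY.
  apply: mpred_all => // h; apply: mpred_imp; first exact: mpred_const.
  by apply: mpred_imp => //; apply: mpred_comp mY.
have exQ j x : exists g, Q j g x.
  have [y Yg [g0 g0r ey]] := Ymax x; rewrite ey in Yg.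
  have exn : exists n, `[<exists2 g, g \in wball mul one inv F (a j) &
      Y (act g x) /\ nu (act g x) = n>].
    exists (nu (act g0 x)); apply/asboolP; exists g0 => //.
    by apply: wball_mono g0r; rewrite // leq_addr.
  case: (ex_minnP exn) => n /asboolP[g ga [Yg' gn]] min; exists g; split=> // h ha Yh.
  by rewrite gn; apply: min; apply/asboolP; exists h.
have sel j := measurable_select cG (mQ j) (exQ j).
have /choice[s sP] (j : 'I_m) : exists s : X -> G,
    (forall x, Q j (s x) x) /\ forall g, mpred (fun x => s x = g).
  by have [s ? ?] := sel j; exists s.
pose p j x := act (s j x) x.
have pY j x : Y (p j x) by have [/(_ x)[]] := sP j.
have pa (j : 'I_m) x : dist F (a j) x (p j x).
  by have [/(_ x)[ga _ _] _] := sP j; exists (s j x).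
have pmin (j : 'I_m) x z : dist F (a j) x z -> Y z -> nu (p j x) <= nu z.
  by move=> [h ha ->] Yh; have [/(_ x)[_ _ ->]] := sP j.
have shell (j : 'I_m) x : ~ constant_on (dist F T x) (p j) ->
    exists y, [/\ Y y, dist F (a j + T) x y & ~ dist F (a j - T) x y].
  move=> nc; apply: contrapT => no; apply: nc => y z xy xz.
  have near w : Y w -> dist F (a j + T) x w -> dist F (a j - T) x w.
    by move=> Yw xw; apply: contrapT => nw; apply: no; exists w.
  have Ta : T <= a j by rewrite /a; nia.
  (* With an empty shell, the marker chosen by [u] is within [a j - T] of [x], so it is also a
     candidate for [v]; by symmetry the least colours agree. *)
  have swap u v : dist F T x u -> dist F T x v -> dist F (a j) v (p j u).
    move=> xu xv; rewrite -(subnKC Ta).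
    apply: dle_trans (dle_sym HG act1 actM xv) _ => //; apply: near; first exact: pY.
    by rewrite addnC; apply: dle_trans xu (pa _ _).
  have nu_eq : nu (p j y) = nu (p j z).
    apply/eqP; rewrite eqn_leq !pmin //; exact: swap.
  have [g g8 ey] : dist F (8 * r) (p j z) (p j y).
    apply: (@dle_mono _ _ _ _ HG _ _ _ (a j + a j)); first by have := aT j (ltn_ord j); lia.
    by apply: dle_trans (swap _ _ xy xz) => //; apply: dle_sym.
  by rewrite ey; apply: nu_inj => //; rewrite -ey.
exists p, (4 * r); split=> [j|j x|x].
- move=> _ B mB; rewrite setTI; have [_ ms] := sP j.
  apply: (@mpred_lift _ X G (s j) (fun g x => B (act g x)) cG) => // g.
  exact: mpred_comp (mact g) mB.
- by apply: dle_mono (pa j x) => //; have := aT j (ltn_ord j); lia.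
- set J := bad_set _ _; have /choice[y yP] (j : 'I_m) : exists y, j \in J ->
      [/\ Y y, dist F (a j + T) x y & ~ dist F (a j - T) x y].
    have [|jN] := boolP (j \in J); last by exists x.
    by move=> /bad_setP/shell[y ?]; exists y.
  (* For j < k one has a j + T <= a k - T: a marker in shell [j] is too close to lie in shell
     [k]. *)
  have y_lt (j k : 'I_m) : j \in J -> k \in J -> j < k -> y j <> y k.
    move=> /yP[_ yj _] /yP[_ _ yk] jk ejk; apply: yk; rewrite -ejk.
    by apply: dle_mono yj => //; rewrite /a; nia.
  rewrite cardE -(size_map y); apply: packing gr _ _ _ => //.
  + rewrite map_inj_in_uniq ?enum_uniq // => j k; rewrite !mem_enum => jJ kJ ejk.
    by apply/val_inj; case: (ltngtP j k) => // lt; [case: (y_lt j k)|case: (y_lt k j)].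
  + move=> _ /mapP[j jJ ->]; rewrite mem_enum in jJ; have [_ yj _] := yP j jJ.
    by apply: dle_mono yj => //; apply: aT.
  + move=> _ _ /mapP[j jJ ->] /mapP[k kJ ->]; rewrite !mem_enum in jJ kJ.
    have [Yj _ _] := yP j jJ; have [Yk _ _] := yP k kJ; exact: Ysep.
Qed.

End Markers.

(** * Perturbing coarse maps along finer ones *)

Lemma leq_card_rel (I J : finType) (A : {set I}) (B : {set J}) (r : I -> J -> Prop) :
  (forall i, i \in A -> exists2 j, j \in B & r i j) ->
  (forall i i' j, r i j -> r i' j -> i = i') -> #|A| <= #|B|.
Proof.
move=> Ar rinj.
(* The option type supplies a value outside [A], where [J] may be empty. *)
have /choice[f fP] i : exists o : option J, i \in A ->
    exists j, [/\ o = Some j, j \in B & r i j].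
  have [/Ar[j jB rj]|iA] := boolP (i \in A); last by exists None.
  by exists (Some j) => _; exists j.
rewrite -(card_in_imset (f := f)) => [|i i' /fP[j [-> _ ri]] /fP[j' [-> _ ri']] [ej]].
  rewrite -(card_imset (f := Some) B) => [|? ? []//].
  apply: subset_leq_card; apply/fintype.subsetP => _ /imsetP[i /fP[j [-> jB _]] ->].
  exact: imset_f.
by apply: rinj ri _; rewrite ej.
Qed.

(** Otherwise the sets grow strictly [d.+1] times and exceed cardinality [d]. *)
Lemma exists_stable (T : finType) (J : nat -> {set T}) d :
  (forall i, J i \subset J i.+1) -> #|J d.+1| <= d -> exists2 i, i <= d & J i = J i.+1.
Proof.
move=> mono Jd; apply: contrapT => no.
have : forall i, i <= d.+1 -> i <= #|J i|.
  elim=> [//|i IH] id; apply: leq_ltn_trans (IH (ltnW id)) _.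
  rewrite proper_card // finset.properEneq mono andbT; apply/eqP => e.
  by apply: no; exists i.
by move=> /(_ d.+1 (leqnn _)) /leq_trans /(_ Jd); rewrite ltnn.
Qed.

(** Strong induction on the value [c n], which strictly drops after any occurrence of [P]. *)
Lemma eventually_not_decreasing (c : nat -> nat) (P : nat -> bool) n :
  (forall s, n <= s -> c s.+1 + P s <= c s) ->
  exists m, forall s, m <= s -> ~~ P s.
Proof.
elim/ltn_ind: {n}(c n) {-2}n (erefl (c n)) => k IH n ck dec.
have [no|] := pselect (forall s, n <= s -> ~~ P s); first by exists n.
move=> /existsNP[s /not_implyP[ns /negP]]; rewrite negbK => Ps.
have mono t : n <= t -> c t <= c n.
  move=> /subnKC <-; elim: (t - n) => [|i IHi]; first by rewrite addn0.
  by rewrite addnS; have := dec _ (leq_addr i n); lia.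
apply: (IH (c s.+1) _ s.+1 erefl) => [|t st].
  by have := dec s ns; rewrite Ps -ck; have := mono s ns; lia.
by apply: dec; apply: leq_trans (ltnW st).
Qed.

Section Refinement.
Variables (G : eqType) (mul : G -> G -> G) (one : G) (inv : G -> G).
Hypothesis HG : is_group mul one inv.
Hypothesis cG : countable_type G.
Variables (disp : measure_display) (X : measurableType disp).
Hypothesis sepX : countably_separated X.
Variable act : G -> X -> X.
Hypothesis actX : borel_action mul one act.

Let act1 x : act one x = x. Proof. by have [H _ _] := actX. Qed.
Let actM g h x : act (mul g h) x = act g (act h x).
Proof. by have [_ H _] := actX. Qed.
Let mact g : measurable_fun setT (act g). Proof. by have [_ _ H] := actX. Qed.

Notation dist := (dle mul one inv act).

Lemma measurable_fun_asbool_if (P : X -> Prop) (f g : X -> X) :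
  mpred P -> measurable_fun setT f -> measurable_fun setT g ->
  measurable_fun setT (fun x => if `[< P x >] then f x else g x).
Proof.
move=> mP mf mg _ B mB; rewrite setTI.
apply: (@mpred_iff _ X _ (fun x => P x /\ B (f x) \/ ~ P x /\ B (g x))).
  move=> x /=; case: asboolP => Px; first by split=> [?|[[]|[]]//]; left.
  by split=> [?|[[]|[]]//]; right.
apply: mpred_or; apply: mpred_and => //; first exact: mpred_comp mf mB.
  exact: mpred_not.
exact: mpred_comp mg mB.
Qed.

Lemma mpred_constant_on F r (f : X -> X) : measurable_fun setT f ->
  mpred (fun x => constant_on (dist F r x) f).
Proof.
move=> mf; pose B := wball mul one inv F r.
apply: (@mpred_iff _ X _ (fun x => forall g h, g \in B -> h \in B ->
    f (act g x) = f (act h x))).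
  move=> x; split=> [cf g h gB hB|cf _ _ [g gB ->] [h hB ->]]; last exact: cf.
  by apply: cf; [exists g|exists h].
apply: mpred_all => // g; apply: mpred_all => // h.
do 2 (apply: mpred_imp; first exact: mpred_const).
by apply: (mpred_eq sepX); apply: measurableT_comp.
Qed.

(* [J i z] is the set of the coarse maps [q j] cutting the ball of radius
   [tau i] at [z].  It has at most [d] elements, so [J i z = J i.+1 z] for some
   [i <= d]; then [J i] is the same at all points near [z] with this property,
   and the [r]-th element [j] of [J i z] can be rounded along the spare
   [a = i * d + r] near [z], with no other [j] using this spare nearby. *)
Lemma refine_family F b d delta L (p : 'I_L -> X -> X) m :
  (forall T, exists (q : 'I_m -> X -> X) (R : nat),
    [/\ forall j, measurable_fun setT (q j), forall j x, dist F R x (q j x) &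
      forall x, #|bad_set q (dist F T x)| <= d]) ->
  d.+1 * d <= L ->
  (forall a, measurable_fun setT (p a)) -> (forall a x, dist F delta x (p a x)) ->
  exists (q : 'I_m -> X -> X) (R : nat),
    [/\ forall j, measurable_fun setT (q j), forall j x, dist F R x (q j x) &
      forall x (C : X -> Prop), C x -> (forall y, C y -> dist F b x y) ->
        #|bad_set q C| <= #|bad_set p C|].
Proof.
move=> kolm dL mp p_loc.
(* From [x] to a point of [C], on to its image under a spare, and on to a zone point that makes the
   spare active: at most b + delta + delta. Two such zone points are within [w + w], the increment
   of [tau]; the summand [L * delta] absorbs all [L] roundings. *)
pose w := b + delta + delta.
pose tau i := b + L * delta + i * (w + w).
have [q [R [mq q_loc q_bad]]] := kolm (tau d.+1).
pose J i z := bad_set q (dist F (tau i) z).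
have JP i z j : reflect (~ constant_on (dist F (tau i) z) (q j)) (j \in J i z).
  exact: bad_setP.
have Jnear i z z' : dist F (w + w) z z' -> J i z' \subset J i.+1 z.
  move=> zz'; apply/fintype.subsetP => j /JP nc; apply/JP => cj; apply: nc.
  apply: constant_onS cj => y z'y; apply: dle_mono (dle_trans HG actM zz' z'y) => //.
  by rewrite /tau mulSn; lia.
have Jmono i z : J i z \subset J i.+1 z by apply: Jnear; apply: dle_refl.
have Jle i k z : i <= k -> J i z \subset J k z.
  move=> /subnKC <-; elim: (k - i) => [|n IH]; first by rewrite addn0.
  by rewrite addnS; apply: fintype.subset_trans (Jmono _ _).
have mJ i A : mpred (fun z => J i z = A).
  apply: (@mpred_iff _ X _ (fun z => forall j,
      if j \in A then ~ constant_on (dist F (tau i) z) (q j)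
      else constant_on (dist F (tau i) z) (q j))).
    move=> z; split=> [<- j|zA]; first by case: JP => // /contrapT.
    by apply/setP => j; have := zA j; case: (j \in A) => [/JP//|cj]; apply/negP => /JP.
  apply: mpred_all => [|j]; first exact: countable_countType.
  by case: (j \in A); [apply: mpred_not|]; apply: mpred_constant_on.
pose zone (j : 'I_m) a z := [/\ J (a %/ d) z = J (a %/ d).+1 z, j \in J (a %/ d) z &
  index j (enum (J (a %/ d) z)) = a %% d].
have mzone j a : mpred (zone j a).
  apply: (@mpred_iff _ X _ (fun z => exists A : {set 'I_m}, J (a %/ d) z = A /\
      (J (a %/ d).+1 z = A /\ (j \in A /\ index j (enum A) = a %% d)))).
    move=> z; split=> [[e jJ ij]|[A [e [e' [jA ij]]]]]; last by rewrite /zone e e'.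
    by exists (J (a %/ d) z); rewrite -e.
  apply: mpred_ex => [|A]; first exact: countable_countType.
  by do 2 apply: mpred_and => //; apply: mpred_const.
have zone_inj x a j k z z' : dist F w x z -> dist F w x z' ->
    zone j a z -> zone k a z' -> j = k.
  move=> xz xz' [e jJ ij] [e' kJ ik].
  have zz' : dist F (w + w) z z' by apply: (dle_trans HG actM) xz'; apply: dle_sym.
  (* Sandwich: the set at either point lies in the next-level set at the other, which equals the set
     at the original level there. *)
  have eJ : J (a %/ d) z = J (a %/ d) z'.
    apply/eqP; rewrite finset.eqEsubset {2}e {1}e' !Jnear //.
    exact: dle_sym.
  rewrite -(nth_index j (s := enum (J (a %/ d) z)) (x := j)) ?mem_enum //.
  by rewrite -[RHS](nth_index j (s := enum (J (a %/ d) z')) (x := k)) ?mem_enum // ij ik eJ.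
pose active j (a : 'I_L) u := exists z, dist F delta u z /\ zone j a z.
(* Spares are applied from the highest index down, then [q j]. Activity is tested at [p a x] and not
   at [x], so points with the same image under [p a] make the same decision. *)
pose rd (j : 'I_m) := fix rd k x := if k is k'.+1 then
  (if insub k' is Some a then
     (if `[< active j a (p a x) >] then rd k' (p a x) else rd k' x)
   else rd k' x) else q j x.
have rdS j (a : 'I_L) x : rd j a.+1 x =
    if `[< active j a (p a x) >] then rd j a (p a x) else rd j a x.
  by rewrite /= valK.
have mrd j k : measurable_fun setT (rd j k).
  elim: k => [|k IH]; first exact: mq.
  rewrite /=; case: insubP => [a _ _|_] //.
  apply: measurable_fun_asbool_if => //.
    by apply: (mpred_comp (f := p a)) => //; apply: mpred_exdist.
  exact: (measurableT_comp IH (mp a)).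
have rd_loc j k x : dist F (R + k * delta) x (rd j k x).
  elim: k x => [|k IH] x; first by rewrite mul0n addn0; exact: q_loc.
  have IH' : dist F (R + k.+1 * delta) x (rd j k x).
    by apply: dle_mono (IH x) => //; rewrite mulSn; lia.
  rewrite /=; case: insubP => [a _ _|_] //; case: ifP => // _.
  rewrite mulSn [delta + _]addnC addnA addnC.
  exact: (dle_trans HG actM) (p_loc a x) (IH _).
exists (fun j => rd j L), (R + L * delta); split=> // x C Cx Cb.
(* Each new map cutting [C] is charged to a spare that cuts [C] and is reserved for it near [x]; by
   [zone_inj] no spare is charged twice. *)
apply: (@leq_card_rel _ _ _ _ (fun j (a : 'I_L) => exists z, dist F w x z /\ zone j a z)).
  move=> j /bad_setP nc; apply: contrapT => no; apply: nc.
  have p_const (a : 'I_L) z : dist F w x z -> zone j a z -> constant_on C (p a).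
    move=> xz za; apply: contrapT => nc; apply: no; exists a; last by exists z.
    exact/bad_setP.
  (* Either the spare is reserved for [j] near [x] and constant on [C], so that all of [C] decides
     alike, or it is inactive on all of [C]. *)
  have rd_const (a : 'I_L) : constant_on C (rd j a) -> constant_on C (rd j a.+1).
    move=> ca y y' Cy Cy'; rewrite !rdS.
    have [[z [xz za]]|nz] := pselect (exists z, dist F w x z /\ zone j a z).
      by rewrite (p_const a z xz za y y') //; case: ifP => // _; apply: ca.
    have inactive v : C v -> `[< active j a (p a v) >] = false.
      move=> Cv; apply/asboolPn => -[z [vz za]]; apply: nz; exists z; split=> //.
      apply: (dle_trans HG actM) vz.
      by apply: (dle_trans HG actM) (p_loc a v); apply: Cb.
    by rewrite !inactive //; apply: ca.
  have [i id stable] : exists2 i, i <= d & J i x = J i.+1 x.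
    by apply: (@exists_stable _ (fun i => J i x)) (q_bad x) => i; apply: Jmono.
  have [jJ|/JP/contrapT cj] := boolP (j \in J i x).
    (* If [q j] cuts the ball of radius [tau i], the spare of level [i] and the rank of [j]
       collapses [C] to a point; later roundings keep it constant. *)
    have jd : index j (enum (J i x)) < d.
      apply: leq_trans (q_bad x); apply: leq_trans (subset_leq_card (Jle i d.+1 x (leqW id))).
      by rewrite cardE index_mem mem_enum.
    have aL : i * d + index j (enum (J i x)) < L by nia.
    pose a := Ordinal aL.
    have za : zone j a x.
      have d0 : 0 < d by apply: leq_ltn_trans jd.
      by split; rewrite /= divnMDl // divn_small // addn0 // modnMDl modn_small.
    have ca : constant_on C (rd j a.+1).
      have on y : C y -> `[< active j a (p a y) >].
        move=> Cy; apply/asboolP; exists x; split=> //.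
        rewrite (p_const a x (dle_refl HG act1 _ _ _) za y x) //.
        exact: dle_sym (p_loc a x).
      move=> y y' Cy Cy'; rewrite !rdS !on //.
      by rewrite (p_const a x (dle_refl HG act1 _ _ _) za y y').
    suff : forall k, a.+1 <= k -> k <= L -> constant_on C (rd j k).
      by apply; rewrite ?ltn_ord.
    elim=> // k IH; rewrite ltnS leq_eqVlt => /orP[/eqP<- //|ak] kL.
    exact: (rd_const (Ordinal kL)) (IH ak (ltnW kL)).
  (* If [q j] is constant on the ball of radius [tau i], the at most [L] roundings never leave that
     ball. Here [L - k] of them have been done. *)
  have rd_q k y : k <= L -> dist F (b + (L - k) * delta) x y -> rd j k y = q j x.
    elim: k y => [|k IH] y kL xy.
      apply: cj; last exact: dle_refl.
      by apply: dle_mono xy => //; rewrite /tau; lia.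
    have xy' : dist F (b + (L - k) * delta) x y.
      by apply: dle_mono xy => //; rewrite leq_add2l leq_mul2r; lia.
    rewrite (rdS j (Ordinal kL)); case: ifP => _; apply: IH => //; try exact: ltnW.
    apply: dle_mono (dle_trans HG actM xy (p_loc (Ordinal kL) y)) => //.
    have -> : L - k = (L - k.+1).+1 by lia.
    by rewrite mulSn; lia.
  by move=> y y' Cy Cy'; rewrite !rd_q // subnn mul0n addn0; apply: Cb.
move=> j k a [z [xz za]] [z' [xz' za']]; exact: (zone_inj _ _ _ _ _ _ xz xz' za za').
Qed.

End Refinement.

(** * Assembling the increasing sequence of finite Borel relations *)

Section Hyperfiniteness.
Variables (G : eqType) (mul : G -> G -> G) (one : G) (inv : G -> G).
Hypothesis HG : is_group mul one inv.
Hypothesis cG : countable_type G.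
Variables (disp : measure_display) (X : measurableType disp).
Hypothesis sepX : countably_separated X.
Variable act : G -> X -> X.
Hypothesis actX : borel_action mul one act.

Let act1 x : act one x = x. Proof. by have [H _ _] := actX. Qed.
Let actM g h x : act (mul g h) x = act g (act h x).
Proof. by have [_ H _] := actX. Qed.

Notation dist := (dle mul one inv act).

Lemma dist_orbit F r x y : dist F r x y -> orbit_eqrel act x y.
Proof. by move=> [g _ ->]; exists g. Qed.

Lemma orbit_eqrel_equivalence : is_equivalence (orbit_eqrel act).
Proof.
split=> [x|x _ [g <-]|x _ _ [g <-] [h <-]].
- by exists one.
- by exists (inv g); rewrite -actM (grp_mulVg HG).
- by exists (mul h g).
Qed.

Lemma finite_dist F r x : finite_set [set y | dist F r x y].
Proof.
apply: sub_finite_set (finite_image (act^~ x) (finite_seq (wball mul one inv F r))).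
by move=> _ [g gr ->]; exists g.
Qed.

(** Separates the contribution of the map set aside, of index [n], from that of the [n] spares. *)
Lemma card_bad_set_recr n (p : nat -> X -> X) C :
  #|bad_set (fun j : 'I_n.+1 => p j) C| =
  #|bad_set (fun j : 'I_n => p j) C| + ~~ `[< constant_on C (p n) >].
Proof.
have card_sum k : #|bad_set (fun j : 'I_k => p j) C| =
    \sum_(j < k) ~~ `[< constant_on C (p j) >].
  rewrite -sum1_card big_mkcond; apply: eq_bigr => j _.
  by rewrite finset.inE; case: asboolP.
by rewrite !card_sum big_ord_recr.
Qed.

Lemma orbit_hyperfinite (F : nat -> seq G) :
  (forall n, {subset F n <= F n.+1}) -> (forall g, exists n, g \in F n) ->
  (forall n, exists K, forall r0, exists2 r, r0 <= r &
     growth mul one inv (F n) (5 * r) <= K * growth mul one inv (F n) r) ->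
  hyperfinite (orbit_eqrel act).
Proof.
move=> FS Fex doubling.
have Fmono m n : m <= n -> {subset F m <= F n}.
  move=> /subnKC <-; elim: (n - m) => [|k IH] g; first by rewrite addn0.
  by move=> /IH/FS; rewrite addnS.
have /choice[d dP] n := kolmogorov_family HG cG sepX actX (doubling n).
(* The number of spares that stage [s] must offer for refining stage [s.+1]; each stage has one more
   map, of index [L s]. *)
pose L s := (d s.+1).+1 * d s.+1.
pose bads n (p : nat -> X -> X) C := bad_set (fun j : 'I_n => p j) C.
pose ok s (p : nat -> X -> X) := (forall j, measurable_fun setT (p j)) /\
  exists R, forall j x, dist (F s) R x (p j x).
have /choice[next nextP] (sp : nat * (nat -> X -> X)) : exists p', ok sp.1 sp.2 ->
    ok sp.1.+1 p' /\ forall x (C : X -> Prop), C x ->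
      (forall y, C y -> dist (F sp.1.+1) 1 x y) ->
      #|bads (L sp.1.+1).+1 p' C| <= #|bads (L sp.1) sp.2 C|.
  case: sp => s p /=; have [[mp [delta p_loc]]|] := pselect (ok s p); last by exists p.
  have [q [R [mq q_loc q_bad]]] := refine_family HG cG sepX actX
    (F := F s.+1) 1 (m := (L s.+1).+1)
    (p := fun j : 'I_(L s) => p j) (dP s.+1 ^~ _) (leqnn _) (fun j => mp j)
    (fun j x => dle_sub HG (FS s) (p_loc j x)).
  exists (fun j => oapp q id (insub j)) => _; split=> [|x C Cx Cb]; last first.
    rewrite /bads (_ : (fun _ => _) = q); first exact: q_bad Cb.
    by apply/funext => j; rewrite valK.
  split=> [j|]; first by case: (insub j) => [i|] /=; [exact: mq|exact: measurable_id].
  exists R => j x; case: (insub j) => [i|] /=; [exact: q_loc|exact: dle_refl].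
(* Identities can start the recursion, since [ok] asks only for measurability and bounded
   displacement. *)
pose P := fix P s := if s is s'.+1 then next (s', P s') else fun _ => id.
have okP s : ok s (P s).
  elim: s => [|s IH]; last by have [] := nextP (s, P s) IH.
  split=> [j|]; first exact: measurable_id.
  by exists 0 => j x; apply: dle_refl.
pose q s := P s (L s).
have q_dist s : exists R, forall x, dist (F s) R x (q s x).
  by have [_ [R RP]] := okP s; exists R => x; apply: RP.
(* The potential counts all maps of stage [s] that cut the ball. The next stage is bounded by the
   spares alone, so the count drops whenever [q s] cuts. Starting at [n] ensures that the ball is
   also small for the generators [F s.+1]. *)
have q_const n x : exists m, forall s, m <= s -> constant_on (dist (F n) 1 x) (q s).
  have [s ns|m mP] := @eventually_not_decreasing
    (fun s => #|bads (L s).+1 (P s) (dist (F n) 1 x)|)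
    (fun s => ~~ `[< constant_on (dist (F n) 1 x) (q s) >]) n.
    rewrite [leqRHS]card_bad_set_recr leq_add2r.
    have [_ /(_ x) next_le] := nextP (s, P s) (okP s).
    apply: next_le; first exact: dle_refl.
    by move=> y; apply/dle_sub/Fmono/leqW.
  by exists m => s /mP; rewrite negbK => /asboolP.
exists (fun m x y => forall k, m <= k -> q k x = q k y); split=> [m|m x y xy k mk|x y].
- split; first split.
  + split=> [x k //|x y xy k mk|x y z xy yz k mk]; first by rewrite xy.
    by rewrite xy ?yz.
  (* A class lies in one fibre of [q m], hence in a ball around the common value. *)
  + move=> x; have [R RP] := q_dist m.
    apply: sub_finite_set (finite_dist (F m) R (q m x)) => y xy /=.
    by rewrite (xy m) //; apply: dle_sym (RP y).
  + apply: (@mpred_all _ (X * X)%type nat (fun k p => m <= k -> q k p.1 = q k p.2)).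
      exact: countable_countType.
    move=> k; apply: (@mpred_imp _ (X * X)%type); first exact: mpred_const.
    by apply: (borel_rel_ker sepX); have [mP _] := okP k; apply: mP.
- exact/xy/ltnW.
- split=> [[g <-]|[n xy]].
    have [n gn] := Fex g; have [m mP] := q_const n x; exists m => k mk.
    apply: (mP k mk); first exact: dle_refl.
    by exists g => //; apply: (wball_letter HG); rewrite (mem_letters HG) gn orbT.
  have [R RP] := q_dist n; have [_ sym trans] := orbit_eqrel_equivalence.
  have := xy n (leqnn n) => qxy; apply: (trans _ (q n x)); first exact: dist_orbit (RP x).
  by rewrite qxy; apply/sym/(dist_orbit (RP y)).
Qed.

End Hyperfiniteness.

Theorem theorem9p3
  (G : Type) (mul : G -> G -> G) (one : G) (inv : G -> G)
  (HG : is_group mul one inv)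
  (Hcount : countable_type G)
  (Hln : locally_nilpotent mul one inv)
  (disp : measure_display) (X : measurableType disp)
  (HX : standard_borel X)
  (act : G -> X -> X)
  (Hact : borel_action mul one act) :
  hyperfinite (orbit_eqrel act).
Proof.
have [c inj_c] := Hcount.
(* [F n] lists the elements of code at most [n], finitely many by injectivity of [c]; [{classic G}]
   supplies the equality test. *)
have /choice[F FP] n : exists s : seq {classic G}, forall g, (g \in s) = (c g <= n).
  elim: n => [|n [s sP]].
    have [[g cg]|no] := pselect (exists g, c g = 0).
      exists [:: g] => h; rewrite inE leqn0 -cg.
      by apply/eqP/eqP => [->//|/inj_c].
    by exists [::] => h; rewrite in_nil leqn0; apply/esym/eqP => h0; apply: no; exists h.
  have [[g cg]|no] := pselect (exists g, c g = n.+1).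
    exists (g :: s) => h; rewrite inE sP [RHS]leq_eqVlt ltnS -cg; congr orb.
    by apply/eqP/eqP => [->//|/inj_c].
  exists s => h; rewrite sP [RHS]leq_eqVlt ltnS; case: eqP => // h0.
  by case: no; exists h.
apply: (@orbit_hyperfinite {classic G} mul one inv HG Hcount _ X
  (standard_borel_separated HX) act Hact F) => [n g|g|n].
- by rewrite !FP => /leqW.
- by exists (c g); rewrite FP.
apply: poly_bounded_doubling (nilpotent_growth (G := {classic G}) HG _) => [r|].
  exact: (growth_gt0 (G := {classic G}) HG).
exact: (Hln _ (finite_seq (F n))).
Qed.
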